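(* Let $\varTheta=\varTheta_A\times\varTheta_\varSigma$ with $\varTheta_A\subseteq\mathbb{R}^{d\times d}$, $\varTheta_\varSigma\subseteq\mathcal{S}^d_{\succ0}$. Assume that the true parameter $(A_\star,\varSigma_\star)$ lies in the interior of $\varTheta$, and that for $(A_1,\varSigma_1),(A_2,\varSigma_2)\in\varTheta$ one has $f_{A_1,\varSigma_1}(x'|x)=f_{A_2,\varSigma_2}(x'|x)$ for all $x,x'\in\mathbb{R}^d$ if and only if $(A_1,\varSigma_1)=(A_2,\varSigma_2)$. Assume further that the data set is $\mathcal{D}=\{(x_i,x_{i+1}):i=1,\dots,N\}$, collected from a single trajectory $x_0,x_1,x_2,\dots$ with $x_i=A_\star x_{i-1}+\varSigma_\star^{1/2}w_{i-1}$ for all $i\ge1$. Then $(A_\star,\varSigma_\star)$ is the unique maximizer over $\varTheta$ of the expected log-likelihood $$\mathcal{L}_{\mathrm{mle}}(A,\varSigma)=\mathbb{E}_{(x,x')\sim d^{\mathcal{D}}}\big[\log f_{A,\varSigma}(x'|x)\big].$$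
   Context: $\mathcal{S}^d_{\succ0}$ is the set of symmetric positive definite $d\times d$ real matrices. The system is $x'=A_\star x+\varSigma_\star^{1/2}w$ with i.i.d. noise $w\in\mathbb{R}^d$ (zero mean, identity covariance) having a known base density $\phi$ that is positive, twice continuously differentiable and has a finite first-order moment. The transition density for parameters $(A,\varSigma)$ is $f_{A,\varSigma}(x'|x)=\det(\varSigma)^{-1/2}\phi\big(\varSigma^{-1/2}(x'-Ax)\big)$. $d^{\mathcal{D}}$ denotes the distribution of the transitions $(x,x')$ in the data set: its current-state marginal has density $d^{\mathcal{D}}(x)$ and, conditionally on $x$, $x'$ has density $f_{A_\star,\varSigma_\star}(\cdot|x)$.
   Formalization: The formal theorem additionally assumes that the expected log-likelihood at the true parameter is not +∞; without this, an unbounded base density with ∫φ log φ = +∞ can make several parameters attain +∞, so the maximizer is not unique. *)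

(* Defs.v *)
From HB Require Import structures.
From mathcomp Require Import all_boot all_order all_algebra finmap.
From mathcomp Require Import all_classical all_reals all_analysis.

Set Implicit Arguments.
Unset Strict Implicit.
Unset Printing Implicit Defensive.

Import Order.TTheory GRing.Theory Num.Theory.
Import numFieldNormedType.Exports.

Local Open Scope classical_set_scope.
Local Open Scope ring_scope.

(* Matrices carry the sigma-algebra generated by the coordinates, as the library
   does for tuples; for the topology of R^(m x n) it is the Borel one. *)
Section measurable_matrix.
Context {R : realType} {m n : nat}.

Definition mx_coord_measurable : set (set 'M[R]_(m, n)) :=
  \bigcup_(ij in [set: 'I_m * 'I_n])
    preimage_set_system [set: 'M[R]_(m, n)] (fun M => M ij.1 ij.2) measurable.

HB.instance Definition _ := @isMeasurable.Build (sigma_display mx_coord_measurable)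
  'M[R]_(m, n) <<s mx_coord_measurable >>
  (@sigma_algebra0 _ setT mx_coord_measurable)
  (@sigma_algebraC _ mx_coord_measurable)
  (@sigma_algebra_bigcup _ setT mx_coord_measurable).

Lemma measurable_mx_coord (i : 'I_m) (j : 'I_n) :
  measurable_fun [set: 'M[R]_(m, n)] (fun M => M i j).
Proof.
move=> _ B mB; rewrite setTI; apply: sub_sigma_algebra.
by exists (i, j) => //; exists B => //; rewrite setTI.
Qed.

End measurable_matrix.

Section lebesgue_cV.
Context {R : realType}.

Definition cV_cons d (p : measurableTypeR R * 'cV[R]_d) : 'cV[R]_d.+1 := col_mx (p.1)%:M p.2.

Lemma measurable_cV_cons d : measurable_fun [set: measurableTypeR R * 'cV[R]_d] (@cV_cons d).
Proof.
apply: measurability => // _ [_ [[i j] _ [B mB <-]] <-].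
rewrite !setTI -comp_preimage -[X in measurable X]setTI.
suff mh : measurable_fun [set: measurableTypeR R * 'cV[R]_d] (fun p => cV_cons p i j).
  exact: mh.
have E p : cV_cons p i j = match @fintype.split 1 d i with
    inl k => (p.1)%:M k j | inr k => p.2 k j end by rewrite mxE.
rewrite (funext E); case: fintype.split => k.
  rewrite (_ : (fun p => _) = fst) //.
  by apply/funext => p; rewrite !ord1 mxE eqxx.
apply: (@measurableT_comp _ _ _ _ _ _ (fun M : 'cV[R]_d => M k j)) => //.
exact: measurable_mx_coord.
Qed.

HB.instance Definition _ d :=
  isMeasurableFun.Build _ _ _ _ (@cV_cons d) (@measurable_cV_cons d).

Section lebesgue_cV_succ.
Local Open Scope ereal_scope.
Variables (d : nat) (mu : {measure set 'cV[R]_d -> \bar R}).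

Definition lebesgue_cV_succ : set 'cV[R]_d.+1 -> \bar R :=
  pushforward (@lebesgue_measure R \x^ mu) (@cV_cons d).

Let lebesgue_cV_succ0 : lebesgue_cV_succ set0 = 0.
Proof. exact: measure0. Qed.

Let lebesgue_cV_succ_ge0 A : 0 <= lebesgue_cV_succ A.
Proof. exact: measure_ge0. Qed.

Let lebesgue_cV_succ_sigma_additive : semi_sigma_additive lebesgue_cV_succ.
Proof. exact: measure_semi_sigma_additive. Qed.

HB.instance Definition _ := isMeasure.Build _ _ _ lebesgue_cV_succ
  lebesgue_cV_succ0 lebesgue_cV_succ_ge0 lebesgue_cV_succ_sigma_additive.

End lebesgue_cV_succ.

(* Lebesgue measure on R^d, as the d-fold product of the one on R. *)
Fixpoint lebesgue_cV d : {measure set 'cV[R]_d -> \bar R} :=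
  if d is d'.+1 then lebesgue_cV_succ (lebesgue_cV d')
  else \d_(0 : 'cV[R]_0).

End lebesgue_cV.

Section positive_definite.
Context {R : realType} {d : nat}.
Implicit Types S : 'M[R]_d.

Definition posdefmx S : Prop :=
  S \is symmetricmx /\ forall v : 'cV[R]_d, v != 0 -> 0 < (v^T *m S *m v) 0 0.

(* Principal square root: for S positive definite, the one positive definite T
   with T *m T = S (the default 0 is never used for such S). *)
Definition sqrtmx S : 'M[R]_d :=
  xget 0 [set T | posdefmx T /\ T *m T = S].

End positive_definite.

Section base_density.
Context {R : realType} {d : nat}.
Implicit Types phi : 'cV[R]_d -> R.

Definition partial (i : 'I_d) phi : 'cV[R]_d -> R := 'D_(delta_mx i 0) phi.

Definition twice_continuously_differentiable phi : Prop :=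
  [/\ forall v, differentiable phi v,
      forall i v, differentiable (partial i phi) v &
      forall i j, continuous (partial j (partial i phi))].

Record base_density phi : Prop := BaseDensity {
  base_density_gt0 : forall v, 0 < phi v ;
  base_density_C2 : twice_continuously_differentiable phi ;
  base_density_mass : (\int[lebesgue_cV d]_v (phi v)%:E = 1)%E ;
  base_density_moment1 : (\int[lebesgue_cV d]_v (`|v| * phi v)%:E < +oo)%E
}.

Definition transition_density phi (A S : 'M[R]_d) (x x' : 'cV[R]_d) : R :=
  (Num.sqrt (\det S))^-1 * phi (invmx (sqrtmx S) *m (x' - A *m x)).

End base_density.

Section random_vectors.
Context {R : realType} {dO : measure_display} {Omega : measurableType dO}.
Variable P : probability Omega R.

Definition mutually_independent {dT : measure_display} {T : measurableType dT}
    (I : choiceType) (X : I -> {RV P >-> T}) : Prop :=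
  forall (J : {fset I}) (B : I -> set T), (forall i, measurable (B i)) ->
    P (\bigcap_(i in [set` J]) (X i @^-1` B i)) =
    (\prod_(i <- J) P (X i @^-1` B i))%E.

Context {d : nat}.

Definition has_density (X : {RV P >-> 'cV[R]_d}) (phi : 'cV[R]_d -> R) : Prop :=
  forall B, measurable B ->
    distribution P X B = (\int[lebesgue_cV d]_(v in B) (phi v)%:E)%E.

Definition zero_mean (X : {RV P >-> 'cV[R]_d}) : Prop :=
  forall i, ('E_P[(fun o => X o i 0)%R] = 0)%E.

Definition identity_covariance (X : {RV P >-> 'cV[R]_d}) : Prop :=
  forall i j, covariance P (fun o => X o i 0) (fun o => X o j 0) = (i == j)%:R%:E.

Definition transition (x : nat -> {RV P >-> 'cV[R]_d}) (i : nat) (o : Omega) :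
  'cV[R]_d * 'cV[R]_d := (x i o, x i.+1 o).

Lemma measurable_transition x i : measurable_fun setT (transition x i).
Proof. exact: measurable_fun_pair. Qed.

HB.instance Definition _ x i :=
  isMeasurableFun.Build _ _ _ _ (transition x i) (measurable_transition x i).

(* Law of a transition drawn uniformly from the N transitions
   (x_1, x_2), ..., (x_N, x_(N+1)); msum runs over k = 0, ..., N - 1. *)
Definition data_distribution (x : nat -> {RV P >-> 'cV[R]_d}) (N : nat) :
    {measure set ('cV[R]_d * 'cV[R]_d) -> \bar R} :=
  mscale (N%:R^-1)%:nng
    (msum (fun k => distribution P (transition x k.+1)) N).

End random_vectors.

Section maximum_likelihood.
Context {R : realType} {d : nat}.

(* Extended-real valued: phi need not be bounded, so \int phi log phi may be +oo,
   in which case the value +oo can be attained at several parameters. *)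
Definition expected_loglik (phi : 'cV[R]_d -> R)
    (mu : {measure set ('cV[R]_d * 'cV[R]_d) -> \bar R})
    (theta : 'M[R]_d * 'M[R]_d) : \bar R :=
  (\int[mu]_p (ln (transition_density phi theta.1 theta.2 p.1 p.2))%:E)%E.

Definition argmax {T : Type} (Theta : set T) (L : T -> \bar R) : set T :=
  [set t | Theta t /\ forall u, Theta u -> (L u <= L t)%E].

(* Symmetric matrices have empty interior among all matrices when 1 < d, so the
   interior of a parameter set is taken in R^(d x d) x Sym_d. *)
Definition parameter_interior (Theta : set ('M[R]_d * 'M[R]_d)) :
    set ('M[R]_d * 'M[R]_d) :=
  interior (Theta : set (subspace [set t : 'M[R]_d * 'M[R]_d |
                                   t.2 \is symmetricmx])).

End maximum_likelihood.

(* Main.v *)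
(* Write r = f_(A,S) / f_(As,Ss) for the likelihood ratio. Integrating the transition density in x'
   gives E[r] = 1 under the data distribution, so E[r - 1 - ln r] is minus the difference of the
   expected log-likelihoods. As r - 1 - ln r >= 0, a parameter whose log-likelihood is not below the
   one of (As, Ss) has r = 1 almost surely; x_1 and x_2 have conditional densities that are positive
   everywhere, so by continuity r = 1 everywhere, and identifiability concludes.
   The subtraction needs a finite log-likelihood at (As, Ss): its negative part is controlled by
   - phi ln phi <= s phi + exp (- s) with s the l^1 norm, that is, by the first moment of phi. *)
Require Import Defs.
From HB Require Import structures.
From mathcomp Require Import all_boot all_order all_algebra finmap.
From mathcomp Require Import all_classical all_reals all_analysis.
From mathcomp Require Import measurable_realfun ring lra.
From mathcomp Require complex.
Set Implicit Arguments.
Unset Strict Implicit.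
Unset Printing Implicit Defensive.
Import Order.TTheory GRing.Theory Num.Theory.
Import numFieldNormedType.Exports.
Local Open Scope classical_set_scope.
Local Open Scope ring_scope.

(** * Square roots and factorization of positive definite matrices *)

(** The noise enters the states through [sqrtmx Ss], so every integral over a next state is taken in
    the noise variable, against [phi]. This calls for an affine change of variables on [lebesgue_cV]
    for positive definite matrices; splitting off one pivot at a time by Schur complements matches
    the recursive definition of that measure. The law of [x 0] is arbitrary and may be singular, for
    instance a point mass. Hence the argument rests on the transition from [x 1] to [x 2]: both
    states have been spread by a noise of positive density, and continuity can turn almost
    everywhere into everywhere. Independence is assumed for [x 0] and the noises; for [x n] and the
    noises from [n] on it has to be propagated along the recursion. *)

Lemma poly_interpolation (F : fieldType) (f : F -> F) (s : seq F) :
  exists q : {poly F}, forall x, x \in s -> q.[x] = f x.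
Proof.
elim: s => [|a s [q qE]]; first by exists 0.
have [as_|aNs] := boolP (a \in s).
  by exists q => x; rewrite inE => /orP[/eqP ->|]; exact: qE.
pose m := \prod_(y <- s) ('X - y%:P).
have ma : m.[a] != 0 by move: aNs; rewrite -root_prod_XsubC.
(* Newton step: the correction is a multiple of [m], which vanishes at all earlier nodes. *)
exists (q + ((f a - q.[a]) / m.[a]) *: m) => x.
rewrite inE hornerD hornerZ => /orP[/eqP ->|xs].
  by rewrite divfK // addrC subrK.
have /eqP -> : m.[x] == 0 by move: xs; rewrite -root_prod_XsubC.
by rewrite mulr0 addr0 qE.
Qed.

Section posdef_theory.
Context {R : realType}.

Lemma symmetricmx_trP d (S : 'M[R]_d) : (S \is symmetricmx) <-> S^T = S.
Proof.
split=> [/is_hermitianmxP|ST].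
  by rewrite expr0 scale1r map_mx_id // => <-.
by apply/is_hermitianmxP; rewrite expr0 scale1r map_mx_id // ST.
Qed.

Lemma posdefmx_unit d (S : 'M[R]_d) : posdefmx S -> S \in unitmx.
Proof.
move=> [Ssym Spos]; rewrite -row_free_unit -kermx_eq0; apply/rowV0P => u /sub_kermxP uS0.
apply/eqP; apply: contraT => u0.
have := Spos u^T; rewrite trmx_eq0 => /(_ u0).
by rewrite trmxK uS0 mul0mx mxE ltxx.
Qed.

Lemma posdefmx_inv d (S : 'M[R]_d) : posdefmx S -> posdefmx (invmx S).
Proof.
move=> Spd; have Su := posdefmx_unit Spd.
have [/symmetricmx_trP ST Spos] := Spd.
split; first by apply/symmetricmx_trP; rewrite trmx_inv ST.
move=> v v0; have := Spos (invmx S *m v).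
rewrite trmx_mul trmx_inv ST !mulmxA mulmxKV //; apply.
by apply: contra_neq v0 => /(congr1 (mulmx S)); rewrite mulKVmx // mulmx0.
Qed.

Section root4.
Import (canonicals) complex.

(* A real polynomial interpolating the fourth root on the spectrum; its square
   evaluated at [S] is then a square root of [S] that is itself a square,
   hence positive. *)
Lemma posdefmx_root4 d (S : 'M[R]_d.+1) : posdefmx S ->
  exists q : {poly R}, horner_mx S q ^+ 4 = S.
Proof.
move=> [/symmetricmx_trP ST Spos].
pose iota : {rmorphism R -> complex.complex R} := complex.real_complex R.
pose A := map_mx iota S.
have Areal : A \is a mxOver Num.real.
  by apply/mxOverP => i j; rewrite mxE; apply/complex.complex_realP; exists (S i j).
have Aherm : A \is hermsymmx.
  apply: realsym_hermsym => //; apply/is_hermitianmxP.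
  rewrite expr0 scale1r map_mx_id //.
  by apply/matrixP => i j; rewrite !mxE -{1}ST mxE.
have AE := orthomx_spectralP (hermitian_normalmx Aherm).
have Dreal := hermitian_spectral_diag_real Aherm.
set U := spectralmx A in AE; set D := spectral_diag A in AE Dreal.
have Uu : U \in unitmx by exact: spectral_unit.
pose r j : R := complex.Re (D 0 j).
have DE j : D 0 j = iota (r j).
  by apply/esym/complex.RRe_real; exact: (mxOverP Dreal).
have UA : U *m A = diag_mx D *m U by rewrite {1}AE !mulmxA mulmxV // mul1mx.
(* Row [j] of [U] is a complex left eigenvector for [r j]. As [S] and [r j] are real, its real part
   [a] and imaginary part [b] are eigenvectors of [S] whenever they are nonzero, and they cannot
   both vanish because [U] is invertible. *)
have r_gt0 j : 0 < r j.
  pose a := map_mx (@complex.Re R) (row j U).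
  pose b := map_mx (@complex.Im R) (row j U).
  have rUA : row j U *m A = D 0 j *: row j U.
    by rewrite -row_mul UA row_mul row_diag_mx -scalemxAl -rowE.
  have aS : a *m S = r j *: a.
    apply/rowP => k; have /rowP/(_ k)/(congr1 (@complex.Re R)) := rUA.
    rewrite !mxE DE raddf_sum /= => E.
    transitivity (\sum_i complex.Re (row j U 0 i * A i k)).
      by apply: eq_bigr => i _; rewrite !mxE; case: (U j i) => x y /=; rewrite mulr0 subr0.
    by rewrite E; case: (U j k) => x y /=; rewrite mul0r subr0.
  have bS : b *m S = r j *: b.
    apply/rowP => k; have /rowP/(_ k)/(congr1 (@complex.Im R)) := rUA.
    rewrite !mxE DE raddf_sum /= => E.
    transitivity (\sum_i complex.Im (row j U 0 i * A i k)).
      by apply: eq_bigr => i _; rewrite !mxE; case: (U j i) => x y /=; rewrite mulr0 add0r.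
    by rewrite E; case: (U j k) => x y /=; rewrite mul0r addr0.
  have key (c : 'rV[R]_d.+1) : c *m S = r j *: c -> c != 0 -> 0 < r j.
    move=> cS c0; have := Spos c^T; rewrite trmx_eq0 => /(_ c0).
    rewrite trmxK cS -scalemxAl mxE => h.
    rewrite ltNge; apply: contraTN h => rj; rewrite -leNgt.
    apply: mulr_le0_ge0 => //; rewrite mxE sumr_ge0 // => i _.
    by rewrite !mxE -expr2 sqr_ge0.
  have [a0|] := eqVneq a 0; last exact: key.
  apply: (key b bS); apply/eqP => b0.
  have : row j U = 0.
    apply/rowP => k; have /rowP/(_ k) := a0; have /rowP/(_ k) := b0.
    by rewrite !mxE; case: (U j k) => x y /= -> ->.
  move=> /(congr1 (fun u => u *m invmx U)).
  rewrite -row_mul mulmxV // mul0mx row1 => /rowP/(_ j).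
  by rewrite !mxE !eqxx => /eqP; rewrite oner_eq0.
have [q qE] := poly_interpolation (fun t : R => Num.sqrt (Num.sqrt t))
  [seq r j | j <- enum 'I_d.+1].
exists q; apply: (@map_mx_inj _ _ iota).
rewrite rmorphXn /= map_horner_mx -/A.
(* On the spectrum [q] is the fourth root, so its fourth power fixes every eigenvalue; nonnegativity
   of [r j] enters here. *)
have qD : map_mx (horner (map_poly iota q ^+ 4)) D = D.
  apply/rowP => j; rewrite mxE DE horner_exp horner_map /= qE; last by rewrite map_f // mem_enum.
  rewrite -rmorphXn /= -[4%N]/(2 * 2)%N exprM !sqr_sqrtr ?sqrtr_ge0 //.
  exact: ltW.
rewrite -rmorphXn /= AE -{2 4}[U]invmxK.
by rewrite horner_mx_uconj ?unitmx_inv // horner_mx_diag qD.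
Qed.

End root4.

(** [sqrtmx] is a choice, so one root has to be exhibited: with [Q ^+ 4 = S] and [Q] a polynomial in
    [S], it is [Q *m Q]. A polynomial in a symmetric matrix is symmetric, so the quadratic form of
    [Q *m Q] at [v] is the sum of squares of [Q v], and [Q v = 0] would force [v = 0] because [S] is
    invertible. *)
Lemma posdefmx_sqrt d (S : 'M[R]_d) : posdefmx S ->
  posdefmx (sqrtmx S) /\ sqrtmx S *m sqrtmx S = S.
Proof.
move=> Spd; suff : exists T, [set T | posdefmx T /\ T *m T = S] T by move=> /(xgetPex 0).
case: d S Spd => [|d] S Spd.
  exists S; split => //; by apply/matrixP => -[].
have [q qE] := posdefmx_root4 Spd; have Su := posdefmx_unit Spd.
have [/symmetricmx_trP ST Spos] := Spd.
set Q := horner_mx S q in qE.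
have QT : Q^T = Q.
  rewrite /Q; elim/poly_ind: q {qE Q} => [|q c IH]; first by rewrite rmorph0 trmx0.
  rewrite rmorphD rmorphM /= horner_mx_X horner_mx_C linearD /= tr_scalar_mx.
  rewrite trmx_mul IH ST; congr (_ + _).
  by have /comm_mx_horner : comm_mx S S by []; apply.
exists (Q *m Q).
have QQ : Q *m Q *m (Q *m Q) = S by rewrite -[RHS]qE 2!exprSr expr2 -mulrA.
split=> //; split; first by apply/symmetricmx_trP; rewrite trmx_mul QT.
move=> v v0; rewrite mulmxA -mulmxA -{1}QT -trmx_mul.
have : Q *m v != 0.
  apply: contraNneq v0 => Qv0.
  by rewrite -[v](mulKmx Su) -QQ -!mulmxA Qv0 !mulmx0.
move: (Q *m v) => u u0; rewrite mxE lt_neqAle sumr_ge0 ?andbT; last first.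
  by move=> i _; rewrite mxE -expr2 sqr_ge0.
apply: contra_neqN u0 => /eqP/esym/eqP.
rewrite psumr_eq0 => [/allP h|i _]; last by rewrite mxE -expr2 sqr_ge0.
apply/colP => i; rewrite mxE; apply/eqP; rewrite -sqrf_eq0 expr2.
by have := h i (mem_index_enum _); rewrite mxE.
Qed.

(* One step of the factorization [L D L^T]: [u] and [X] are the pivot column
   and the Schur complement of the pivot [a]. *)
Lemma posdefmx_schur d (S : 'M[R]_(1 + d)) : posdefmx S ->
  exists a (u : 'cV[R]_d) (X : 'M[R]_d),
    [/\ 0 < a, posdefmx X, \det S = a * \det X &
        S = block_mx a%:M (a *: u^T) (a *: u) (X + a *: (u *m u^T))].
Proof.
move=> [/symmetricmx_trP ST Spos].
pose a := S 0 0; pose u := a^-1 *: dlsubmx S.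
pose X := drsubmx S - a *: (u *m u^T).
have a_gt0 : 0 < a.
  have := Spos (delta_mx 0 0); rewrite trmx_delta -rowE -colE !mxE; apply.
  by apply/eqP => /matrixP/(_ 0 0)/eqP; rewrite !mxE !eqxx oner_eq0.
have aE : ulsubmx S = a%:M.
  by rewrite [LHS]mx11_scalar; congr (_%:M); rewrite !mxE; congr (S _ _); apply/val_inj.
have uE : dlsubmx S = a *: u by rewrite scalerA mulfV ?gt_eqF // scale1r.
have utE : ursubmx S = a *: u^T by rewrite -linearZ /= -uE trmx_dlsub ST.
have SE : S = block_mx a%:M (a *: u^T) (a *: u) (X + a *: (u *m u^T)).
  by rewrite -aE -uE -utE subrK submxK.
exists a, u, X; split => //.
- split.
    apply/symmetricmx_trP; rewrite linearB linearZ /= trmx_mul trmxK.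
    by rewrite trmx_drsub ST.
  move=> v v0.
  (* This vector completes the square: [S] sends it to [(0, X v)], so the quadratic form of [S]
     there is that of [X] at [v]. *)
  have := Spos (col_mx (- (u^T *m v)) v).
  rewrite -mulmxA SE mul_block_col tr_col_mx mul_scalar_mx.
  rewrite -scalemxAl scalerN addNr mulmxDl mulmxN -!scalemxAl mulmxA addrCA addNr addr0.
  rewrite mul_row_col mulmx0 add0r mulmxA; apply.
  by apply: contra_neq v0 => /(congr1 dsubmx); rewrite col_mxKd => ->; rewrite linear0.
- have -> : S = block_mx 1%:M 0 u 1%:M *m block_mx a%:M (a *: u^T) 0 X.
    rewrite mulmx_block !mul0mx !mulmx0 !mul1mx !addr0 [LHS]SE.
    by rewrite mul_mx_scalar -scalemxAr addrC.
  by rewrite det_mulmx det_lblock det_ublock !det1 !mul1r det_scalar1.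
Qed.

Lemma posdefmx_det_gt0 d (S : 'M[R]_d) : posdefmx S -> 0 < \det S.
Proof.
elim: d S => [S _|d IH S Spd]; first by rewrite det_mx00.
have [a [u [X [a0 Xpd -> _]]]] := @posdefmx_schur d S Spd.
by rewrite mulr_gt0 // IH.
Qed.

Lemma posdefmx_det_sqrt d (S : 'M[R]_d) : posdefmx S ->
  Num.sqrt (\det S) = \det (sqrtmx S).
Proof.
move=> /posdefmx_sqrt[Tpd {1}<-].
by rewrite det_mulmx -expr2 sqrtr_sqr gtr0_norm // posdefmx_det_gt0.
Qed.

End posdef_theory.

(** * Lebesgue measure on column vectors *)

Section matrix_borel.
Context {R : realType}.

Lemma measurable_fun_mx {dT} {T : measurableType dT} m n (f : T -> 'M[R]_(m, n)) :
  (forall i j, measurable_fun setT (fun t => f t i j)) -> measurable_fun setT f.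
Proof.
move=> mf; apply: (measurability mx_coord_measurable) => // _ [_ [[i j] _ [B mB <-]] <-].
by rewrite !setTI -comp_preimage -[X in measurable X]setTI; exact: (mf i j).
Qed.

Lemma measurable_ball_mx m n (c : 'M[R]_(m, n)) (e : R) : measurable (ball c e).
Proof.
have [e0|e0] := ltP 0 e; last first.
  by rewrite (_ : ball c e = set0) //; apply/seteqP; split => // M []; rewrite ltNge e0.
have -> : ball c e = \bigcap_(ij in [set: 'I_m * 'I_n])
    ((fun M : 'M[R]_(m, n) => M ij.1 ij.2) @^-1` ball (c ij.1 ij.2) e).
  apply/seteqP; split => [M [_ cM] [i j] _|M cM]; first exact: cM.
  by split => // i j; exact: (cM (i, j) I).
apply: fin_bigcap_measurable => // -[i j] _; rewrite -[X in measurable X]setTI.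
by apply: measurable_mx_coord => //; exact: measurable_ball.
Qed.

(** Balls are finite intersections of coordinate conditions, hence measurable, and an open set is
    the union of those balls of rational centre and radius [1 / (k + 1)] that it contains, a
    countable family. *)
Lemma open_measurable_mx m n (U : set 'M[R]_(m, n)) : open U -> measurable U.
Proof.
move=> Uo.
pose q (p : 'M[rat]_(m, n) * nat) : set 'M[R]_(m, n) :=
  ball (map_mx ratr p.1 : 'M[R]_(m, n)) p.2.+1%:R^-1.
have -> : U = \bigcup_p (if `[< q p `<=` U >] then q p else set0).
  apply/seteqP; split => [x Ux|x [p _]]; last by case: asboolP => // pU /pU.
  have /nbhs_ballP[e e0 xeU] := open_nbhs_nbhs (conj Uo Ux).
  have e20 : 0 < e / 2 by rewrite divr_gt0.
  (* The radius is below [e / 2], so a ball of this radius that contains [x] lies in the ball of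
     radius [e] around [x]. *)
  pose k := Num.truncn (e / 2)^-1.
  have ke : k.+1%:R^-1 < e / 2 by rewrite invf_plt ?posrE // truncnS_gt.
  have k0 : 0 < k.+1%:R^-1 :> R by rewrite invr_gt0.
  have dense_q i j : exists r : rat, ball (x i j) k.+1%:R^-1 (ratr r).
    have [|r] := @rat_in_itvoo R (x i j - k.+1%:R^-1) (x i j + k.+1%:R^-1).
      by rewrite ltrD2l gt0_cp.
    by exists r; rewrite ball_itv.
  pose p := (\matrix_(i, j) xget 0 [set r : rat | ball (x i j) k.+1%:R^-1 (ratr r)], k).
  have xp : ball x k.+1%:R^-1 (map_mx ratr p.1).
    by split => // i j; rewrite !mxE; exact: xgetPex (dense_q i j).
  exists p => //; case: asboolP => [_|]; first exact: ball_sym.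
  move=> H; case: H => y py; apply: xeU; rewrite /q -ball_normE /= in xp py *.
  apply: (@le_lt_trans _ _ (`|x - map_mx ratr p.1| + `|map_mx ratr p.1 - y|)).
    by rewrite -[x - y](subrKA (map_mx ratr p.1)) ler_normD.
  rewrite [ltRHS]splitr; apply: ltrD; [exact: lt_trans xp ke|exact: lt_trans py ke].
apply: countable_bigcupT_measurable; first exact: countableP.
by move=> p; case: ifP => _ //; exact: measurable_ball_mx.
Qed.

Lemma continuous_measurable_mx m n (f : 'M[R]_(m, n) -> R) :
  continuous f -> measurable_fun setT f.
Proof.
move=> /continuousP cf.
apply: (measurability _ (RGenOpens.measurableE R)).
move=> _ [_ [a [b ->]] <-]; rewrite setTI; apply: open_measurable_mx; apply: cf.
exact: interval_open.
Qed.

End matrix_borel.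

Section lebesgue_cV_theory.
Context {R : realType}.
Implicit Type d : nat.

Lemma cV_cons0 d (p : R * 'cV[R]_d) : cV_cons p 0 0 = p.1.
Proof.
have -> : (0 : 'I_d.+1) = lshift d (0 : 'I_1) by exact/val_inj.
by rewrite [LHS]col_mxEu mxE eqxx.
Qed.

Lemma cV_consS d (p : R * 'cV[R]_d) i : cV_cons p (rshift 1 i) 0 = p.2 i 0.
Proof. by rewrite [LHS]col_mxEd. Qed.

(** The sup-norm ball as a product of intervals, the form in which induction on the dimension
    computes its volume. *)
Definition box d (c : 'cV[R]_d) (e : R) : set 'cV[R]_d :=
  [set v | forall i, `|c i 0 - v i 0| < e].

Lemma ball_box d (c : 'cV[R]_d) (e : R) : 0 < e -> ball c e = box c e.
Proof.
move=> e0; apply/seteqP; split => [v [_ cv] i|v cv]; first exact: cv.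
by split => // i j; rewrite (ord1 j); exact: cv.
Qed.

Lemma lebesgue_cV_box d (c : 'cV[R]_d) (e : R) : 0 < e ->
  lebesgue_cV d (box c e) = ((e *+ 2) ^+ d)%:E.
Proof.
move=> e0; elim: d c => [c|d IH c].
  by rewrite /= diracE mem_set // => -[].
rewrite [LHS](_ : _ = (@lebesgue_measure R \x^ lebesgue_cV d)%E
    (ball (c 0 0) e `*` box (dsubmx (c : 'cV[R]_(1 + d))) e)%classic).
  rewrite product_measure2E ?IH.
  - by rewrite exprS EFinM /= lebesgue_measure_ball // ltW.
  - exact: measurable_ball.
  - by rewrite -ball_box //; exact: measurable_ball_mx.
congr product_measure2; apply/seteqP; split => [p cp|p [p0 p1] i] /=.
  split; first by have := cp 0; rewrite cV_cons0.
  by move=> i; rewrite mxE -cV_consS; exact: cp.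
have [j ->|j ->] := split_ordP (i : 'I_(1 + d)).
  rewrite ord1 (_ : lshift d 0 = 0) ?cV_cons0 //; exact/val_inj.
by rewrite cV_consS; have := p1 j; rewrite mxE.
Qed.

(* [lebesgue_cV d] under a name of its own, to attach its sigma-finiteness to. *)
Definition lebV d : set 'cV[R]_d -> \bar R := lebesgue_cV d.

HB.instance Definition _ d := Measure.copy (@lebV d) (lebesgue_cV d).

Lemma lebV_sigma_finite d : sigma_finite setT (@lebV d).
Proof.
exists (fun k => box 0 k.+1%:R).
  apply/seteqP; split=> // v _; exists (Num.truncn `|v|) => // i /=.
  rewrite mxE sub0r normrN (le_lt_trans _ (truncnS_gt _)) //.
  by rewrite [leRHS]/Num.Def.normr /= mx_normrE; apply/bigmax_geP; right => /=; exists (i, 0).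
move=> k; split; first by rewrite -ball_box //; exact: measurable_ball_mx.
by rewrite /lebV lebesgue_cV_box // ltry.
Qed.

HB.instance Definition _ d := Measure_isSigmaFinite.Build _ _ _ (@lebV d)
  (@lebV_sigma_finite d).

Local Open Scope ereal_scope.

(** [lebesgue_cV] is built from the product [\x^], while the Tonelli theorems are stated for [\x].
    The two agree on rectangles, hence everywhere by sigma-finiteness. *)
Lemma integral_lebV_cons d (f : 'cV[R]_d.+1 -> \bar R) :
  measurable_fun [set: 'cV[R]_d.+1] f -> (forall v, 0 <= f v) ->
  \int[@lebV d.+1]_v f v =
  \int[@lebesgue_measure R \x @lebV d]_p f (cV_cons p).
Proof.
move=> mf f0.
have mfc : measurable_fun [set: measurableTypeR R * 'cV[R]_d] (f \o @cV_cons R d).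
  by apply: measurableT_comp => //; exact: measurable_cV_cons.
transitivity (\int[pushforward (@lebesgue_measure R \x^ @lebV d) (@cV_cons R d)]_v f v) => //.
rewrite ge0_integral_pushforward //=.
apply: eq_measure_integral => A mA _.
apply/esym/product_measure_unique => // B C mB mC.
exact: product_measure2E.
Qed.

End lebesgue_cV_theory.

(** * Affine change of variables, one pivot at a time *)

Section affine_change_of_variables.
Context {R : realType}.

Lemma measurable_mxD {dT} {T : measurableType dT} m n (f g : T -> 'M[R]_(m, n)) :
  measurable_fun setT f -> measurable_fun setT g ->
  measurable_fun setT (fun t => f t + g t).
Proof.
move=> mf mg; apply: measurable_fun_mx => i j.
under eq_fun do rewrite mxE.
by apply: measurable_funD; apply: (measurableT_comp (measurable_mx_coord i j)).
Qed.

Lemma measurable_mulmx {dT} {T : measurableType dT} m n p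
    (A : 'M[R]_(m, n)) (f : T -> 'M[R]_(n, p)) :
  measurable_fun setT f -> measurable_fun setT (fun t => A *m f t).
Proof.
move=> mf; apply: measurable_fun_mx => i j.
under eq_fun do rewrite mxE.
apply: measurable_sum => k; apply: measurable_funM => //.
exact: (measurableT_comp (measurable_mx_coord k j)).
Qed.

Lemma measurable_scalemx {dT} {T : measurableType dT} m n
    (A : 'M[R]_(m, n)) (f : T -> R) :
  measurable_fun setT f -> measurable_fun setT (fun t => f t *: A).
Proof.
move=> mf; apply: measurable_fun_mx => i j.
by under eq_fun do rewrite mxE; exact: measurable_funM.
Qed.

(** The lower block depends on [s] only through the new pivot coordinate [t]. The affine map thus
    splits into a scalar map [s] to [t] for fixed [y] and an affine map of [y] with matrix [X] for
    fixed [t]. *)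
Lemma schur_block_affine d (a c0 s : R) (u c1 y : 'cV[R]_d) (X : 'M[R]_d) :
  let t := a * s + (a * (u^T *m y) 0 0 + c0) in
  block_mx a%:M (a *: u^T) (a *: u) (X + a *: (u *m u^T)) *m col_mx s%:M y
    + col_mx c0%:M c1 = col_mx t%:M (X *m y + ((t - c0) *: u + c1)).
Proof.
move=> t; rewrite mul_block_col add_col_mx -scalar_mxM -scalemxAl.
rewrite {1}[u^T *m y]mx11_scalar scale_scalar_mx -!raddfD /= -addrA -/t.
congr col_mx; rewrite mul_mx_scalar scalerA mulmxDl -scalemxAl -mulmxA.
rewrite {1}[u^T *m y]mx11_scalar mul_mx_scalar scalerA !addrA; congr (_ + _).
rewrite [X in X + _ = _]addrC -addrA; congr (_ + _); rewrite -scalerDl; congr (_ *: _).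
by rewrite /t !addrA addrK addrC [s * a]mulrC addrC.
Qed.

Local Open Scope ereal_scope.

(** The image of Lebesgue measure under [t] to [a * t + c], scaled by [a], gives half-open intervals
    their length, so it is Lebesgue measure. *)
Lemma integral_affine (f : R -> \bar R) (a c : R) : (0 < a)%R ->
  measurable_fun setT f -> (forall t, 0 <= f t) ->
  \int[@lebesgue_measure R]_t f (a * t + c)%R =
  a^-1%:E * \int[@lebesgue_measure R]_t f t.
Proof.
move=> a0 mf f0.
pose h (t : measurableTypeR R) : measurableTypeR R := (a * t + c)%R.
have mh : measurable_fun setT h by apply: measurable_funD => //; exact: measurable_funM.
have a0' : (0 <= a)%R by exact: ltW.
pose mu : {measure set (measurableTypeR R) -> \bar R} :=
  mscale (NngNum a0') (pushforward (@lebesgue_measure R) h).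
have muE : forall A, measurable A -> @lebesgue_measure R A = mu mh A.
  apply: lebesgue_measure_unique => X [[x y] _ <-].
  rewrite /mu /= /mscale /= /pushforward.
  have -> : h @^-1` `]x, y]%classic = `]((x - c) / a)%R, ((y - c) / a)%R]%classic.
    apply/seteqP; split => t; rewrite /h /= !in_itv /=.
      by rewrite ltr_pdivrMr // ler_pdivlMr // ltrBlDr lerBrDr mulrC.
    by rewrite ltr_pdivrMr // ler_pdivlMr // ltrBlDr lerBrDr mulrC.
  rewrite !lebesgue_measure_itv /= !lte_fin ltr_pM2r ?invr_gt0 // ltrD2r.
  case: ifP => _; last by rewrite mule0.
  by rewrite -!EFinB -EFinM; congr (_%:E); field; rewrite gt_eqF.
have -> : \int[@lebesgue_measure R]_t f t = \int[mu mh]_t f t.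
  by apply: eq_measure_integral => A mA _; exact: muE.
rewrite ge0_integral_mscale // ge0_integral_pushforward //=.
by rewrite muleA -EFinM mulVf ?gt_eqF // mul1e.
Qed.

(** Induction along the Schur factorization: substituting [t] for [s] contributes [a^-1], the
    induction hypothesis for [X] contributes [(\det X)^-1], and [\det T = a * \det X]. *)
Lemma integral_lebV_affine d (T : 'M[R]_d) (c : 'cV[R]_d) (f : 'cV[R]_d -> \bar R) :
  posdefmx T -> measurable_fun setT f -> (forall v, 0 <= f v) ->
  \int[@lebV R d]_v f (T *m v + c)%R = (\det T)^-1%:E * \int[@lebV R d]_v f v.
Proof.
elim: d T c f => [|d IH] T c f Tpd mf f0.
  rewrite det_mx00 invr1 mul1e; apply: eq_integral => v _; congr f.
  by apply/matrixP => -[].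
have [a [u [X [a0 Xpd dT TE]]]] := @posdefmx_schur R d T Tpd.
pose c0 : R := c 0%R 0%R; pose c1 := dsubmx (c : 'cV[R]_(1 + d)).
pose e t := ((t - c0) *: u + c1)%R.
have mcons : measurable_fun [set: measurableTypeR R * 'cV[R]_d] (@cV_cons R d).
  exact: measurable_cV_cons.
pose g (p : measurableTypeR R * 'cV[R]_d) := f (cV_cons (p.1, X *m p.2 + e p.1)%R).
have mg : measurable_fun setT g.
  apply: (measurableT_comp mf); apply: (measurableT_comp mcons).
  apply: measurable_fun_pair => //=; apply: measurable_mxD.
    by apply: measurable_mulmx; exact: measurable_snd.
  apply: measurable_mxD => //; apply: measurable_scalemx.
  by apply: measurable_funB => //; exact: measurable_fst.
have mfc : measurable_fun setT (f \o @cV_cons R d) by exact: measurableT_comp.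
have mT : measurable_fun setT (fun v => f (T *m v + c)%R).
  by apply: (measurableT_comp mf); apply: measurable_mxD => //; exact: measurable_mulmx.
have gE s y : f (T *m cV_cons (s, y) + c)%R =
    g ((a * s + (a * (u^T *m y) 0 0 + c0))%R, y).
  rewrite /g /=; congr f.
  have cE : c = col_mx c0%:M c1 :> 'cV[R]_(1 + d).
    transitivity (col_mx (usubmx (c : 'cV_(1 + d))) c1); first by rewrite vsubmxK.
    congr (col_mx _ _); rewrite [LHS]mx11_scalar.
    by congr (_%:M)%R; rewrite mxE; congr (c _ _); exact/val_inj.
  by rewrite TE {1}cE; exact: schur_block_affine.
rewrite !integral_lebV_cons //.
transitivity (\int[@lebV R d]_y \int[@lebesgue_measure R]_s
    g ((a * s + (a * (u^T *m y) 0 0 + c0))%R, y)).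
  rewrite (fubini_tonelli2 _ (measurableT_comp mT mcons) (fun=> f0 _)) /=.
  by apply: eq_integral => y _; apply: eq_integral => s _; exact: gE.
transitivity (\int[@lebV R d]_y (a^-1%:E * \int[@lebesgue_measure R]_t g (t, y))).
  apply: eq_integral => y _.
  refine (@integral_affine (fun t => g (t, y)) a _ a0 _ _) => [|t].
    by apply: (measurableT_comp mg); exact: measurable_fun_pair.
  exact: f0.
rewrite ge0_integralZl //=; last 3 first.
- apply: (@measurable_fun_fubini_tonelli_G _ _ _ _ _ (@lebesgue_measure R) g) => //.
  by move=> p; exact: f0.
- by move=> y _; apply: integral_ge0 => t _; exact: f0.
- by rewrite lee_fin invr_ge0 ltW.
(* The order is exchanged: [s] was integrated with [y] fixed, whereas the induction hypothesis needs
   [t] fixed, since the shift [e t] depends on it. *)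
rewrite -fubini_tonelli //=; last by move=> p; exact: f0.
rewrite (fubini_tonelli1 _ mfc (fun=> f0 _)) /=.
rewrite dT invfM EFinM -muleA; congr (_ * _).
rewrite -ge0_integralZl //=; last 3 first.
- apply: (@measurable_fun_fubini_tonelli_F _ _ _ _ _ (@lebV R d) (f \o @cV_cons R d)) => //.
  by move=> p; exact: f0.
- by move=> t _; apply: integral_ge0 => y _; exact: f0.
- by rewrite lee_fin invr_ge0 ltW // posdefmx_det_gt0.
apply: eq_integral => t _; apply: (IH X (e t) (fun y => f (cV_cons (t, y)))) => //.
by apply: (measurableT_comp mfc); exact: measurable_fun_pair.
Qed.

End affine_change_of_variables.

Section lebesgue_cV_integrals.
Context {R : realType}.
Local Open Scope ereal_scope.

(** By symmetry this is twice the integral over the half-line, where the integrand is the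
    exponential density of rate 1. *)
Lemma integral_expR_abs : \int[@lebesgue_measure R]_t (expR (- `|t|))%:E < +oo.
Proof.
have cf : continuous (fun t : R => expR (- `|t|)).
  by move=> t; apply: continuous_comp; [apply: cvgN; exact: norm_continuous|exact: continuous_expR].
rewrite (@ge0_symfun_integralT R) //; last by move=> t /=; rewrite normrN.
rewrite lte_mul_pinfty ?lee_fin //.
have mpdf := @measurable_exponential_pdf R 1.
apply: (@le_lt_trans _ _ (\int[@lebesgue_measure R]_t (exponential_pdf 1 t)%:E)); last first.
  by rewrite integral_exponential_pdf ?ltry.
rewrite -set_itvcy.
apply: (@le_trans _ _ (\int[@lebesgue_measure R]_(t in `[0%R, +oo[) (exponential_pdf 1 t)%:E)).
  apply: ge0_le_integral => //.
  - by apply/measurable_EFinP; apply: measurable_funTS; exact: continuous_measurable_fun.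
  - by apply/measurable_EFinP; exact: measurable_funTS.
  - move=> t; rewrite /= in_itv /= andbT => t0.
    by rewrite lee_fin exponential_pdfE // mul1r mulN1r ger0_norm.
apply: ge0_subset_integral => //; first exact/measurable_EFinP.
by move=> t _; rewrite lee_fin exponential_pdf_ge0.
Qed.

(** With the l^1 norm in the exponent the integrand is a product over the coordinates, so Tonelli
    reduces it to dimension one. *)
Lemma integral_expR_l1norm d :
  \int[@lebV R d]_v (expR (- \sum_i `|v i 0|))%:E < +oo.
Proof.
have mq k : measurable_fun [set: 'cV[R]_k] (fun v => (expR (- \sum_i `|v i 0|))%:E).
  apply/measurable_EFinP; apply: measurableT_comp => //; apply: measurableT_comp => //.
  apply: measurable_sum => i; apply: measurableT_comp => //; exact: measurable_mx_coord.
elim: d => [|d IH].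
  rewrite (eq_integral (cst 1)); last by move=> v _; rewrite big_ord0 oppr0 expR0.
  by rewrite integral_cst //= /lebV /= diracE mem_set // mule1 ltry.
rewrite integral_lebV_cons //.
have E (p : measurableTypeR R * 'cV[R]_d) :
    (expR (- \sum_i `|cV_cons p i 0|))%:E =
    (expR (- `|p.1|))%:E * (expR (- \sum_i `|p.2 i 0|))%:E.
  rewrite -EFinM -expRD -opprD; congr (expR (- _))%:E.
  rewrite big_ord_recl cV_cons0; congr (_ + _)%R.
  by apply: eq_bigr => i _; rewrite -cV_consS; congr (`|cV_cons p _ 0|%R); exact/val_inj.
under eq_integral do rewrite E.
rewrite fubini_tonelli1 /=; last 2 first.
- apply: emeasurable_funM.
    apply/measurable_EFinP; apply: measurableT_comp => //; apply: measurableT_comp => //.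
    by apply: measurableT_comp => //; exact: measurable_fst.
  by apply: (measurableT_comp (mq d)); exact: measurable_snd.
- by move=> p; rewrite mule_ge0 // lee_fin expR_ge0.
under eq_integral do rewrite /fubini_F /= ge0_integralZl //=.
have I0 : 0 <= \int[@lebV R d]_v (expR (- \sum_i `|v i 0|))%:E.
  by apply: integral_ge0 => v _; rewrite lee_fin expR_ge0.
rewrite -(@fineK _ (\int[@lebV R d]_v _)) ?ge0_fin_numE //.
rewrite ge0_integralZr //=; last 2 first.
- by apply/measurable_EFinP; apply: measurableT_comp => //; apply: measurableT_comp.
- by rewrite lee_fin fine_ge0.
rewrite muleC lte_mul_pinfty ?lee_fin ?fine_ge0 ?integral_expR_abs //.
Qed.

(** A positive value would persist on a ball, and a ball of radius [e] has volume [(2 e)^d > 0]. *)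
Lemma continuous_integral0 d (h : 'cV[R]_d -> R) : continuous h ->
  (forall v, 0 <= h v)%R -> \int[@lebV R d]_v (h v)%:E = 0 -> forall v, h v = 0%R.
Proof.
move=> ch h0 hint v0; apply: contrapT => /eqP hv0.
have hv : (0 < h v0)%R by rewrite lt_neqAle eq_sym hv0 h0.
have mh := continuous_measurable_mx ch.
have /ae_eq_integral_abs : \int[@lebV R d]_(v in setT) `|(h v)%:E| = 0.
  by rewrite -hint; apply: eq_integral => v _; rewrite gee0_abs // lee_fin.
move=> /(_ measurableT (proj2 (measurable_EFinP _ _) mh)) hae.
have /nbhs_ballP[e /= e0 he] : \forall v \near v0, (0 < h v)%R by exact: (cvgr_gt _ (ch v0)).
have : (@lebV R d) (ball v0 e) = 0.
  apply: measure_negligible; first exact: measurable_ball_mx.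
  apply: negligibleS hae => v /he hv_gt0 /=; apply/not_implyP; split => //.
  by case=> hv1; move: hv_gt0; rewrite hv1 ltxx.
rewrite ball_box // /lebV lebesgue_cV_box // => -[] /eqP.
by rewrite expf_eq0 mulrn_eq0 /= gt_eqF ?andbF.
Qed.

End lebesgue_cV_integrals.

(** * Law of the transitions *)

Section measure_with_density.
Context {dT} {T : measurableType dT} {R : realType}.
Local Open Scope ereal_scope.

(** [phi] and the Radon-Nikodym derivative of [nu] have the same integral over every measurable set,
    so they agree almost everywhere, and the change of variables for the derivative carries over. *)
Lemma integral_density (nu : {finite_measure set T -> \bar R})
    (mu : {sigma_finite_measure set T -> \bar R}) (phi : T -> R) (f : T -> \bar R) :
  measurable_fun setT phi -> (forall t, 0 <= phi t)%R ->
  (forall B, measurable B -> nu B = \int[mu]_(t in B) (phi t)%:E) ->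
  measurable_fun setT f -> (forall t, 0 <= f t) ->
  \int[nu]_t f t = \int[mu]_t (f t * (phi t)%:E).
Proof.
move=> mphi phi0 nuE mf f0.
have numu : nu `<< mu.
  apply/null_content_dominatesP => A mA muA.
  by rewrite nuE // null_set_integral //; apply/measurable_EFinP; exact: measurable_funTS.
have phii : mu.-integrable setT (EFin \o phi).
  apply/integrableP; split; first exact/measurable_EFinP.
  under eq_integral do rewrite /= ger0_norm //.
  by rewrite -nuE // ltey_eq fin_num_measure.
rewrite -(Radon_Nikodym_SigmaFinite.change_of_variables numu f0) //.
have mg := measurable_int _ (Radon_Nikodym_SigmaFinite.f_integrable numu).
apply: ae_eq_integral => //.
- exact: emeasurable_funM.
- by apply: emeasurable_funM => //; exact/measurable_EFinP.
- apply: ae_eqe_mul2l; apply: ae_eq_sym; apply: integral_ae_eq => // E _ mE.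
  by rewrite -Radon_Nikodym_SigmaFinite.f_integral // nuE.
Qed.

End measure_with_density.

Section independence.
Context {R : realType} {dO : measure_display} {Omega : measurableType dO}.
Variable P : probability Omega R.
Local Open Scope ereal_scope.

(** Both sides are finite measures in [C] that agree on rectangles. The event [E] stands for the
    later noises; [E = setT] gives the joint law of the pair. *)
Lemma independent_pair {d1 d2} {T1 : measurableType d1} {T2 : measurableType d2}
    (X : {RV P >-> T1}) (Y : {RV P >-> T2}) (E : set Omega) :
  measurable E ->
  (forall A B, measurable A -> measurable B ->
    P (X @^-1` A `&` (Y @^-1` B `&` E)) = P (X @^-1` A) * (P (Y @^-1` B) * P E)) ->
  forall C, measurable C ->
    P ((fun o => (X o, Y o)) @^-1` C `&` E) =
    (distribution P X \x distribution P Y) C * P E.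
Proof.
move=> mE XYE C mC.
have mXY : measurable_fun setT (fun o => (X o, Y o)) by exact: measurable_fun_pair.
have PE : P E \is a fin_num by exact: fin_num_measure.
have p0 : (0 <= fine (P E))%R by exact: fine_ge0.
(* The factor [P E] is absorbed in the second marginal, which makes the right-hand side a product
   measure. *)
pose m2 : {finite_measure set T2 -> \bar R} := mscale (NngNum p0) (distribution P Y).
pose m' : {measure set (T1 * T2) -> \bar R} :=
  pushforward (mrestr P mE) (fun o => (X o, Y o)).
rewrite [LHS](_ : _ = m' mXY C) //.
rewrite -(@product_measure_unique _ _ _ _ _ (distribution P X) m2 (m' mXY)) //.
  rewrite /product_measure1 muleC -ge0_integralZl //=; last first.
    exact: measurable_fun_xsection.
  by apply: eq_integral => t _; rewrite /m2 /= /mscale /= fineK.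
move=> A B mA mB; rewrite /m' /m2 /= /mscale /= /pushforward /mrestr /= fineK //.
rewrite [X in P (X `&` E)](_ : _ = X @^-1` A `&` Y @^-1` B) //.
by rewrite -setIA XYE // [P E * _]muleC.
Qed.

End independence.

(** * Independence of each state from the current and later noises *)

Section trajectory.
Context {R : realType} {d : nat} {dO : measure_display} {Omega : measurableType dO}.
Variable P : probability Omega R.
Variables (w x : nat -> {RV P >-> 'cV[R]_d}) (A T : 'M[R]_d).
Hypothesis Hindep : mutually_independent (fun i : nat => if i is k.+1 then w k else x 0%N).
Hypothesis Htraj : forall i o, x i.+1 o = A *m x i o + T *m w i o.

Local Notation future n m B := (\bigcap_(j < m) (w (n + j)%N @^-1` B j)).

Lemma measurable_future n m (B : nat -> set 'cV[R]_d) :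
  (forall j, measurable (B j)) -> measurable (future n m B).
Proof.
move=> mB; apply: fin_bigcap_measurable => [|j _]; first exact: finite_II.
by rewrite -[X in measurable X]setTI; exact: measurable_funPT.
Qed.

Local Open Scope ereal_scope.

Lemma measurable_step :
  measurable_fun setT (fun p : 'cV[R]_d * 'cV[R]_d => (p.1, A *m p.1 + T *m p.2)%R).
Proof.
apply: measurable_fun_pair; first exact: measurable_fst.
by apply: measurable_mxD; apply: measurable_mulmx; [exact: measurable_fst|exact: measurable_snd].
Qed.

(** The case of a single noise, phrased as an implication so that it serves both inside the
    induction below and after it. *)
Lemma state_noise_of_future n (A1 A2 : set 'cV[R]_d) :
  P (x n @^-1` A1 `&` future n 1 (fun=> A2)) =
    P (x n @^-1` A1) * \prod_(j < 1) P (w (n + j)%N @^-1` A2) ->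
  P (x n @^-1` A1 `&` w n @^-1` A2) = P (x n @^-1` A1) * P (w n @^-1` A2).
Proof.
rewrite big_ord1 addn0 => <-; congr (P (_ `&` _)).
by apply/seteqP; split=> [t h [|//] _ /=|t h]; [rewrite addn0|have := h 0%N isT; rewrite /= addn0].
Qed.

(** [x n.+1] is a function of [(x n, w n)], and this pair is independent of the next [m] noises by
    the claim at [n] with [m.+1] noises. Hence the induction on [n] keeps [m] general. *)
Lemma state_future_independent n m (B0 : set 'cV[R]_d) (B : nat -> set 'cV[R]_d) :
  measurable B0 -> (forall j, measurable (B j)) ->
  P (x n @^-1` B0 `&` future n m B) =
  P (x n @^-1` B0) * \prod_(j < m) P (w (n + j)%N @^-1` B j).
Proof.
elim: n m B0 B => [|n IH] m B0 B mB0 mB.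
  (* In the independent family index 0 is the initial state, and noise [j] sits at index [j.+1]. *)
  pose B' i := if i is j.+1 then B j else B0.
  have mB' i : measurable (B' i) by case: i.
  pose J := [fset i in iota 0 m.+1]%fset.
  have memJ i : (i \in J) = (i < m.+1)%N by rewrite in_fset mem_iota.
  have := Hindep J mB'.
  rewrite [X in P X = _](_ : _ = x 0%N @^-1` B0 `&` future 0%N m B); last first.
    apply/seteqP; split=> [t h|t [h0 h] [|k] kJ //].
      split=> [|j jm]; first by apply: (h 0%N); change (0%N \in J); rewrite memJ.
      by apply: (h j.+1); change (j.+1 \in J); rewrite memJ.
    by apply: (h k); have : k.+1 \in J := kJ; rewrite memJ.
  move=> ->; rewrite (perm_big (iota 0 m.+1)) /=; last first.
    apply: uniq_perm; [exact: fset_uniq|exact: (iota_uniq 0 m.+1)|].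
    by move=> i; rewrite memJ -[_ :: _]/(iota 0 m.+1) mem_iota.
  rewrite big_cons; congr (_ * _).
  have -> : iota 1 m = map (addn 1) (iota 0 m) by rewrite -iotaDl.
  rewrite big_map -[RHS](big_mkord xpredT (fun j => P (w j @^-1` B j))).
  by rewrite /index_iota subn0.
pose E := future n.+1 m B.
have mE : measurable E by exact: measurable_future.
(* The induction hypothesis with trivial conditions on [x n] and [w n]. *)
have PE : P E = \prod_(j < m) P (w (n.+1 + j)%N @^-1` B j).
  have := IH m.+1 setT (fun i => if i is j.+1 then B j else setT) measurableT.
  rewrite !preimage_setT setTI probability_setT mul1e big_ord_recl /=.
  rewrite preimage_setT probability_setT mul1e => h.
  transitivity (P (future n m.+1 (fun i => if i is j.+1 then B j else setT))).
    congr (P _); apply/seteqP; split=> [t h' [|k] /= km //|t h' j /= jm].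
      by have := h' k km; rewrite /= addnS.
    by have := h' j.+1 jm; rewrite /= addnS.
  rewrite h; last by case.
  by apply: eq_bigr => i _; rewrite addnS.
have key C : measurable C -> P ((fun o => (x n o, w n o)) @^-1` C `&` E) =
    (distribution P (x n) \x distribution P (w n)) C * P E.
  apply: independent_pair => // A1 A2 mA1 mA2.
  pose B' i := if i is j.+1 then B j else A2.
  have mB' i : measurable (B' i) by case: i.
  have futE : future n m.+1 B' = w n @^-1` A2 `&` E.
    apply/seteqP; split=> [t h|t [h0 h] [|k] /= km].
    - split=> [|j /= jm]; first by have := h 0%N isT; rewrite /= addn0.
      by have := h j.+1 jm; rewrite /= addnS.
    - by rewrite addn0.
    - by have := h k km; rewrite /= addnS.
  rewrite -futE IH // big_ord_recl /= addn0 PE; congr (_ * (_ * _)).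
  by apply: eq_bigr => i _; rewrite addnS.
pose G (p : 'cV[R]_d * 'cV[R]_d) := (A *m p.1 + T *m p.2)%R.
have mC : measurable (G @^-1` B0).
  rewrite -[X in measurable X]setTI.
  exact: (measurableT_comp (@measurable_snd _ _ _ _) measurable_step).
have xE : x n.+1 @^-1` B0 = (fun o => (x n o, w n o)) @^-1` (G @^-1` B0).
  by apply/seteqP; split => o; rewrite /= Htraj.
rewrite xE key //.
have key0 : P ((fun o => (x n o, w n o)) @^-1` (G @^-1` B0)) =
    (distribution P (x n) \x distribution P (w n)) (G @^-1` B0).
  rewrite -[RHS]mule1 -(@probability_setT _ _ _ P) -independent_pair // ?setIT //.
  move=> A1 A2 mA1 mA2; rewrite setIT probability_setT mule1.
  by apply: state_noise_of_future; apply: IH.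
by rewrite key0 PE.
Qed.

Lemma state_noise_independent n (A1 A2 : set 'cV[R]_d) :
  measurable A1 -> measurable A2 ->
  P (x n @^-1` A1 `&` w n @^-1` A2) = P (x n @^-1` A1) * P (w n @^-1` A2).
Proof. by move=> mA1 mA2; apply: state_noise_of_future; exact: state_future_independent. Qed.

End trajectory.

Section transition_law.
Context {R : realType} {d : nat} {dO : measure_display} {Omega : measurableType dO}.
Variable P : probability Omega R.
Variables (w x : nat -> {RV P >-> 'cV[R]_d}) (A T : 'M[R]_d).
Hypothesis Hindep : mutually_independent (fun i : nat => if i is k.+1 then w k else x 0%N).
Hypothesis Htraj : forall i o, x i.+1 o = A *m x i o + T *m w i o.
Variable phi : 'cV[R]_d -> R.
Hypothesis mphi : measurable_fun setT phi.
Hypothesis phi0 : forall v, 0 <= phi v.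
Hypothesis Hdens : forall i, has_density (w i) phi.
Local Open Scope ereal_scope.

(** The transition is the image of [(x n, w n)], whose law is a product; the noise alone is given a
    density, so the law of [x n] may be anything. *)
Lemma integral_transition n (h : 'cV[R]_d * 'cV[R]_d -> \bar R) :
  measurable_fun setT h -> (forall p, 0 <= h p) ->
  \int[distribution P (transition x n)]_p h p =
  \int[distribution P (x n)]_y \int[@lebV R d]_z
    (h (y, A *m y + T *m z)%R * (phi z)%:E).
Proof.
move=> mh h0.
have mxw : measurable_fun setT (fun o => (x n o, w n o)) by exact: measurable_fun_pair.
have mG := @measurable_step R d A T.
set G := (fun p : 'cV[R]_d * 'cV[R]_d => _) in mG.
have mhG : measurable_fun setT (h \o G) by exact: measurableT_comp.
rewrite ge0_integral_pushforward //=.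
transitivity (\int[P]_o (h \o G) (x n o, w n o)).
  by apply: eq_integral => o _; rewrite /= /transition Htraj.
rewrite -(@ge0_integral_pushforward _ _ _ _ _ _ mxw P setT (h \o G)) //; last first.
  by move=> p _; exact: h0.
rewrite (@eq_measure_integral _ _ _ setT
  (distribution P (x n) \x distribution P (w n))); last first.
  move=> C mC _; rewrite /pushforward.
  rewrite -[RHS]mule1 -(@probability_setT _ _ _ P) -independent_pair // ?setIT //.
  move=> A1 A2 mA1 mA2; rewrite setIT probability_setT mule1.
  exact: (state_noise_independent Hindep Htraj).
rewrite fubini_tonelli1 //; last by move=> p; exact: h0.
apply: eq_integral => y _; apply: integral_density => //.
- by move=> B mB; exact: Hdens.
- by apply: (measurableT_comp mhG); exact: measurable_fun_pair.
- by move=> z; exact: h0.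
Qed.

Lemma integral_state_succ n (h : 'cV[R]_d -> \bar R) :
  measurable_fun setT h -> (forall p, 0 <= h p) ->
  \int[distribution P (x n.+1)]_y h y =
  \int[distribution P (x n)]_y \int[@lebV R d]_z (h (A *m y + T *m z)%R * (phi z)%:E).
Proof.
move=> mh h0.
have mh2 : measurable_fun setT (fun p : 'cV[R]_d * 'cV[R]_d => h p.2).
  by apply: (measurableT_comp mh); exact: measurable_snd.
rewrite -(@integral_transition n (fun p => h p.2)) //.
by rewrite !ge0_integral_pushforward.
Qed.

End transition_law.

(** * Gibbs inequality and the maximizer *)

Section gibbs_inequality.
Context {dT} {T : measurableType dT} {R : realType}.
Variable mu : {measure set T -> \bar R}.
Local Open Scope ereal_scope.

Lemma integrable_funeposneg (f : T -> \bar R) : measurable_fun setT f ->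
  \int[mu]_t f^\+ t < +oo -> \int[mu]_t f^\- t < +oo -> mu.-integrable setT f.
Proof.
move=> mf fp fn; apply/integrableP; split => //.
rewrite (eq_integral (f^\+ \+ f^\-)); last by move=> t _; rewrite -(congr1 (@^~ t) (fune_abse f)).
rewrite ge0_integralD //; first exact: lte_add_pinfty.
- exact: measurable_funepos.
- exact: measurable_funeneg.
Qed.

Lemma integrable_funeneg_lty (f : T -> \bar R) : measurable_fun setT f ->
  \int[mu]_t f^\- t < +oo -> \int[mu]_t f t < +oo -> mu.-integrable setT f.
Proof.
move=> mf fn; rewrite integralE => fi; apply: integrable_funeposneg => //.
have n0 : 0 <= \int[mu]_t f^\- t by apply: integral_ge0.
rewrite ltNge; apply/negP; rewrite leye_eq => /eqP fpoo; move: fi.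
by rewrite fpoo addye ?ltxx // eqe_oppLR /= lt_eqF.
Qed.

Lemma integrable_funepos_gtNy (f : T -> \bar R) : measurable_fun setT f ->
  \int[mu]_t f^\+ t < +oo -> -oo < \int[mu]_t f t -> mu.-integrable setT f.
Proof.
move=> mf fp; rewrite integralE => fi; apply: integrable_funeposneg => //.
rewrite ltNge; apply/negP; rewrite leye_eq => /eqP fnoo; move: fi.
by rewrite fnoo /= addeNy.
Qed.

Lemma gibbs_equality (l ls : T -> R) :
  mu setT = 1 -> measurable_fun setT l -> measurable_fun setT ls ->
  \int[mu]_t (EFin \o ls)^\- t < +oo -> \int[mu]_t (ls t)%:E < +oo ->
  \int[mu]_t (expR (l t - ls t))%:E = 1 ->
  \int[mu]_t (ls t)%:E <= \int[mu]_t (l t)%:E ->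
  \int[mu]_t (expR (l t - ls t) - 1 - (l t - ls t))%:E = 0.
Proof.
move=> mu1 ml mls lsn lsi r1 lsl.
have ils : mu.-integrable setT (EFin \o ls).
  by apply: integrable_funeneg_lty => //; exact/measurable_EFinP.
have mr : measurable_fun setT (fun t => expR (l t - ls t)).
  by apply: measurableT_comp => //; exact: measurable_funB.
have ir : mu.-integrable setT (EFin \o (fun t => expR (l t - ls t))).
  apply/integrableP; split; first exact/measurable_EFinP.
  under eq_integral do rewrite /= ger0_norm ?expR_ge0 //.
  by rewrite r1 ltry.
(* Since [l - ls <= expR (l - ls)], the positive part of [l] is at most [|ls| + expR (l - ls)]; the
   integral of [l] is not [-oo], being at least the finite integral of [ls]. *)
have il : mu.-integrable setT (EFin \o l).
  apply: integrable_funepos_gtNy; first exact/measurable_EFinP.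
    have [_ ilsoo] := integrableP _ _ _ ils; have [_ iroo] := integrableP _ _ _ ir.
    apply: le_lt_trans (lte_add_pinfty ilsoo iroo).
    rewrite -ge0_integralD //; last 2 first.
    - by apply: measurableT_comp => //; exact/measurable_EFinP.
    - by apply: measurableT_comp => //; exact/measurable_EFinP.
    apply: ge0_le_integral => //.
    - by apply: measurable_funepos; exact/measurable_EFinP.
    - by apply: emeasurable_funD; apply: measurableT_comp => //; exact/measurable_EFinP.
    - move=> t _; rewrite funeposE /= -EFinD ge_max !lee_fin addr_ge0 // andbT.
      have := expR_ge1Dx (l t - ls t); have := ler_norm (ls t).
      by rewrite (ger0_norm (expR_ge0 _)); lra.
  apply: lt_le_trans lsl; rewrite ltNye_eq.
  by rewrite (integrable_fin_num _ ils).
have i1 : mu.-integrable setT (EFin \o (cst 1%R : T -> R)).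
  apply/integrableP; split; first exact/measurable_EFinP.
  rewrite (eq_integral (cst 1)); last by move=> t _; rewrite /= normr1.
  by rewrite integral_cst // mul1e mu1 ltry.
have il_ls : mu.-integrable setT (EFin \o (fun t => l t - ls t)%R).
  rewrite (_ : _ \o _ = (EFin \o l) \- (EFin \o ls)) //; exact: integrableB.
have ir1 : mu.-integrable setT (EFin \o (fun t => expR (l t - ls t) - 1)%R).
  rewrite (_ : _ \o _ =
    (EFin \o (fun t => expR (l t - ls t))) \- (EFin \o (cst 1%R))) //.
  exact: integrableB.
(* The integrand is nonnegative pointwise. Conversely its integral is [(1 - 1)] minus the difference
   of the integrals of [l] and [ls], hence at most 0. *)
apply/eqP; rewrite eq_le; apply/andP; split; last first.
  by apply: integral_ge0 => t _; rewrite lee_fin; have := expR_ge1Dx (l t - ls t); lra.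
rewrite [leLHS](_ : _ = \int[mu]_t ((expR (l t - ls t) - 1)%:E - (l t - ls t)%:E)) //.
rewrite integralB //.
rewrite [X in X - _](_ : _ = 0); last first.
  under eq_integral do rewrite EFinB.
  by rewrite integralB // r1 integral_cst // mul1e mu1 subee.
under eq_integral do rewrite EFinB.
rewrite integralB // sub0e oppeB ?fin_num_adde_defl ?integrable_fin_num //.
  by rewrite addeC sube_le0.
by rewrite fin_numN (integrable_fin_num _ ils).
Qed.

End gibbs_inequality.

(** * The log-likelihood in the noise variable *)

Section likelihood.
Context {R : realType} {d : nat}.
Implicit Types (A S : 'M[R]_d) (v y z : 'cV[R]_d).

Lemma continuous_affine_mx m n (N : 'M[R]_(m, n)) (b : 'cV[R]_m) :
  continuous (fun v : 'cV[R]_n => N *m v + b).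
Proof.
move=> v0; apply: (@cvgD _ 'cV[R]_m _ (nbhs v0) _ (mulmx N) (fun=> b) (N *m v0) b);
  last exact: cvg_cst.
have E : mulmx N = (fun v : 'cV[R]_n => \sum_k v k 0 *: col k N).
  apply/funext => v; apply/colP => i; rewrite mxE summxE.
  by apply: eq_bigr => k _; rewrite !mxE mulrC.
suff : (\sum_k (v : 'cV[R]_n) k 0 *: col k N) @[v --> v0] -->
    (\sum_k v0 k 0 *: col k N) by rewrite E.
have FF : Filter (nbhs v0) by exact: nbhs_filter.
apply: (@cvg_big _ _ _ _ _ _ _ _ _ _ _ FF) => [|k _]; first exact: add_continuous.
by apply: cvgZr_tmp; exact: coord_continuous.
Qed.

Variable phi : 'cV[R]_d -> R.
Hypothesis Hphi : base_density phi.

Lemma base_density_continuous : continuous phi.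
Proof.
have [dphi _ _] := base_density_C2 Hphi.
by move=> v; exact: (differentiable_continuous (dphi v)).
Qed.

Lemma base_density_measurable : measurable_fun setT phi.
Proof. by apply: continuous_measurable_mx; exact: base_density_continuous. Qed.

Let phi_gt0 : forall v, 0 < phi v := base_density_gt0 Hphi.

Lemma transition_density_gt0 A S y z : posdefmx S -> 0 < transition_density phi A S y z.
Proof.
by move=> Spd; rewrite mulr_gt0 // invr_gt0 sqrtr_gt0 posdefmx_det_gt0.
Qed.

(** In the noise variable the state [y] drops out, so at the true parameter bounds on the
    log-likelihood are uniform in [y]. *)
Lemma transition_density_noise A S y z : posdefmx S ->
  transition_density phi A S y (A *m y + sqrtmx S *m z) =
  (\det (sqrtmx S))^-1 * phi z.
Proof.
move=> Spd; have [Tpd _] := posdefmx_sqrt Spd.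
rewrite /transition_density posdefmx_det_sqrt // addrAC subrr add0r.
by rewrite mulKmx // posdefmx_unit.
Qed.

Lemma measurable_transition_density A S :
  measurable_fun setT
    (fun p : 'cV[R]_d * 'cV[R]_d => transition_density phi A S p.1 p.2).
Proof.
apply: measurable_funM => //; apply: (measurableT_comp base_density_measurable).
apply: measurable_mulmx; under eq_fun do rewrite -mulNmx.
apply: measurable_mxD; first exact: measurable_snd.
by apply: measurable_mulmx; exact: measurable_fst.
Qed.

Definition loglik A S (p : 'cV[R]_d * 'cV[R]_d) : R :=
  ln (transition_density phi A S p.1 p.2).

Lemma measurable_loglik A S : measurable_fun setT (loglik A S).
Proof. by apply: (measurableT_comp (@measurable_ln R)); exact: measurable_transition_density. Qed.

(** Letting both arguments run affinely over one vector covers the dependence on the current state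
    and the dependence on the noise at once. *)
Lemma continuous_loglik_affine n A S (M1 M2 : 'M[R]_(d, n)) (b1 b2 : 'cV[R]_d) :
  posdefmx S ->
  continuous (fun v : 'cV[R]_n => loglik A S (M1 *m v + b1, M2 *m v + b2)).
Proof.
move=> Spd v.
apply: (@continuous_comp _ _ _ (fun v : 'cV[R]_n =>
    transition_density phi A S (M1 *m v + b1) (M2 *m v + b2)) (@ln R)); last first.
  by apply: continuous_ln; exact: transition_density_gt0.
set M := invmx (sqrtmx S).
pose N := M *m (M2 - A *m M1); pose b := M *m (b2 - A *m b1).
have -> : (fun v : 'cV[R]_n => transition_density phi A S (M1 *m v + b1) (M2 *m v + b2)) =
    (fun v : 'cV[R]_n => (Num.sqrt (\det S))^-1 * phi (N *m v + b)).
  apply/funext => v'; rewrite /transition_density; congr (_ * phi _).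
  by rewrite -/M /N /b -mulmxA -mulmxDr mulmxBl mulmxDr opprD addrACA mulmxA.
apply: (@continuousM _ _ (fun=> _) (fun v : 'cV[R]_n => phi (N *m v + b))).
  exact: cst_continuous.
apply: (@continuous_comp _ _ _ (fun v : 'cV[R]_n => N *m v + b) phi).
  exact: continuous_affine_mx.
exact: base_density_continuous.
Qed.

Local Open Scope ereal_scope.

(** The likelihood ratio times [phi z] is [\det (sqrtmx Ss)] times the density for [(A, S)] at the
    next state. The substitution by [sqrtmx Ss] cancels that determinant, and the one by
    [invmx (sqrtmx S)] turns the rest into the total mass of [phi]. *)
Lemma integral_transition_density A S As Ss y : posdefmx S -> posdefmx Ss ->
  \int[@lebV R d]_z ((expR (loglik A S (y, As *m y + sqrtmx Ss *m z)
      - loglik As Ss (y, As *m y + sqrtmx Ss *m z))%R)%:E * (phi z)%:E) = 1.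
Proof.
move=> Spd Sspd; have [Tpd _] := posdefmx_sqrt Spd; have [Tspd _] := posdefmx_sqrt Sspd.
have dT := posdefmx_det_gt0 Tpd; have dTs := posdefmx_det_gt0 Tspd.
pose M := invmx (sqrtmx S).
pose f v := (phi (M *m v + - (M *m (A *m y)))%R)%:E.
have mphi : measurable_fun setT (EFin \o phi).
  by apply/measurable_EFinP; exact: base_density_measurable.
have mf : measurable_fun setT f.
  apply: (measurableT_comp mphi); apply: measurable_mxD => //.
  by apply: measurable_mulmx.
transitivity (\int[@lebV R d]_z (((\det (sqrtmx S))^-1 * \det (sqrtmx Ss))%:E
    * f (sqrtmx Ss *m z + As *m y)%R)).
  apply: eq_integral => z _; rewrite -EFinM /f -EFinM; congr (_%:E).
  rewrite expRD expRN /loglik !lnK ?posrE ?transition_density_gt0 //=.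
  rewrite transition_density_noise // invfM invrK.
  rewrite /transition_density posdefmx_det_sqrt // -/M mulmxBr [(As *m y + _)%R]addrC.
  by rewrite mulrACA [(_ * phi z)%R]mulrC mulrA; field; rewrite !gt_eqF.
have f0 v : 0 <= f v by rewrite lee_fin; apply: ltW.
rewrite ge0_integralZl //; last 2 first.
- by apply: (measurableT_comp mf); apply: measurable_mxD => //; apply: measurable_mulmx.
- by rewrite lee_fin mulr_ge0 // ?invr_ge0 ltW.
rewrite integral_lebV_affine //.
rewrite (@integral_lebV_affine R d M (- (M *m (A *m y)))%R (EFin \o phi)) //; last 2 first.
- exact: posdefmx_inv.
- by move=> z; rewrite lee_fin; apply: ltW.
rewrite [X in _ * (_ * (_ * X))](base_density_mass Hphi) mule1 -!EFinM det_inv invrK.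
by congr (_%:E); field; rewrite !gt_eqF.
Qed.

Lemma integral_neg_log_density (a : R) :
  \int[@lebV R d]_z ((Num.max (- (a + ln (phi z))) 0)%R%:E * (phi z)%:E) < +oo.
Proof.
pose s z : R := (\sum_i `|z i 0|)%R.
have ms : measurable_fun setT s.
  apply: measurable_sum => i; apply: measurableT_comp => //; exact: measurable_mx_coord.
have mphi := base_density_measurable.
have mn : measurable_fun setT (fun z : 'cV[R]_d => `|z|%R).
  by apply: continuous_measurable_mx; exact: norm_continuous.
(* The dominating function; the factor [d] appears because the first moment is in the sup norm and
   the l^1 norm is at most [d] times it. *)
pose B z := (`|a|%:E * (phi z)%:E + d%:R%:E * (`|z| * phi z)%:E) + (expR (- s z))%:E.
have m1 : measurable_fun setT (fun z => `|a|%:E * (phi z)%:E).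
  by apply: emeasurable_funM => //; exact/measurable_EFinP.
have m2 : measurable_fun setT (fun z => d%:R%:E * (`|z| * phi z)%:E).
  by apply: emeasurable_funM => //; apply/measurable_EFinP; exact: measurable_funM.
have m3 : measurable_fun setT (fun z => (expR (- s z))%:E).
  by apply/measurable_EFinP; apply: measurableT_comp => //; exact: measurableT_comp.
have p1 z : 0 <= `|a|%:E * (phi z)%:E by rewrite mule_ge0 // lee_fin ltW.
have p2 z : 0 <= d%:R%:E * (`|z| * phi z)%:E.
  by rewrite mule_ge0 // lee_fin // mulr_ge0 // ltW.
apply: (@le_lt_trans _ _ (\int[@lebV R d]_z B z)).
  apply: ge0_le_integral => //.
  - by move=> z _; rewrite mule_ge0 // lee_fin ?le_max ?lexx ?orbT // ltW.
  - apply: emeasurable_funM; last exact/measurable_EFinP.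
    apply/measurable_EFinP; apply: measurable_maxr => //.
    apply: measurableT_comp => //; apply: measurable_funD => //.
    by apply: (measurableT_comp (@measurable_ln R)).
  - by apply: emeasurable_funD => //; exact: emeasurable_funD.
  - move=> z _; rewrite /B -!EFinM -!EFinD lee_fin.
    have pz := phi_gt0 z.
    have sz : (s z <= d%:R * `|z|)%R.
      rewrite /s -[d in d%:R]card_ord mulr_natl -sumr_const ler_sum // => i _.
      by rewrite [leRHS]/Num.Def.normr /= mx_normrE; apply/bigmax_geP; right => /=; exists (i, 0%R).
    have q0 := expR_gt0 (- s z)%R.
    (* This is [ln u <= u - 1] at [u = expR (- s z) / phi z], multiplied by [phi z]. *)
    have key : (- ln (phi z) * phi z <= s z * phi z + expR (- s z))%R.
      have : (ln (expR (- s z) / phi z) <= expR (- s z) / phi z - 1)%R.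
        have h : (-1 < expR (- s z) / phi z - 1)%R by rewrite ltrBrDl subrr divr_gt0.
        by have := le_ln1Dx h; rewrite addrC subrK.
      rewrite ln_div ?posrE // expRK => h.
      have : ((- s z - ln (phi z)) * phi z <= (expR (- s z) / phi z - 1) * phi z)%R.
        by rewrite ler_pM2r.
      by rewrite !mulrBl divfK ?gt_eqF // !mulNr mul1r; lra.
    have s2 : (s z * phi z <= d%:R * (`|z| * phi z))%R by rewrite mulrA ler_pM2r.
    have a2 : (- a * phi z <= `|a| * phi z)%R by rewrite ler_pM2r // -normrN ler_norm.
    have z1 : (0 <= `|a| * phi z)%R by rewrite mulr_ge0 // ltW.
    have z2 : (0 <= d%:R * (`|z| * phi z))%R by rewrite !mulr_ge0 // ltW.
    have [_|_] := leP (- (a + ln (phi z)))%R 0%R; first by rewrite mul0r; lra.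
    by rewrite opprD mulrDl; lra.
rewrite ge0_integralD //; last 2 first.
- by move=> z _; exact: adde_ge0.
- exact: emeasurable_funD.
rewrite ge0_integralD // !ge0_integralZl //; last 4 first.
- by apply/measurable_EFinP; exact: measurable_funM.
- by move=> z _; rewrite lee_fin mulr_ge0 // ltW.
- exact/measurable_EFinP.
- by move=> z _; rewrite lee_fin ltW.
apply: lte_add_pinfty; last exact: integral_expR_l1norm.
apply: lte_add_pinfty; apply: lte_mul_pinfty => //.
- by rewrite [ltLHS](base_density_mass Hphi) ltry.
- exact: (base_density_moment1 Hphi).
Qed.

End likelihood.

Section zero_integral.
Local Open Scope ereal_scope.

Lemma integral0_ae_eq {dT} {T : measurableType dT} {R : realType}
    (mu : {measure set T -> \bar R}) (f : T -> \bar R) :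
  measurable_fun setT f -> (forall t, 0 <= f t) -> \int[mu]_t f t = 0 ->
  ae_eq mu setT f (cst 0).
Proof.
move=> mf f0 fi; apply/ae_eq_integral_abs => //.
by rewrite -fi; apply: eq_integral => t _; rewrite gee0_abs.
Qed.

Lemma probability_integral0_ex {dT} {T : measurableType dT} {R : realType}
    (mu : probability T R) (f : T -> \bar R) :
  measurable_fun setT f -> (forall t, 0 <= f t) -> \int[mu]_t f t = 0 ->
  exists t, f t = 0.
Proof.
move=> mf f0 /(integral0_ae_eq mf f0) fae; apply: contrapT => nf.
have : mu setT = 0.
  apply: measure_negligible => //; apply: negligibleS fae => t _ /= h.
  by apply: nf; exists t; exact: h.
by rewrite probability_setT => /eqP; rewrite onee_eq0.
Qed.

End zero_integral.

Section data_distribution_theory.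
Context {R : realType} {d : nat} {dO : measure_display} {Omega : measurableType dO}.
Variables (P : probability Omega R) (x : nat -> {RV P >-> 'cV[R]_d}) (N : nat).
Local Open Scope ereal_scope.

Lemma integral_data_distribution (h : 'cV[R]_d * 'cV[R]_d -> \bar R) :
  measurable_fun setT h -> (forall p, 0 <= h p) ->
  \int[data_distribution x N]_p h p =
  N%:R^-1%:E * \sum_(k < N) \int[distribution P (transition x k.+1)]_p h p.
Proof.
by move=> mh h0; rewrite ge0_integral_mscale // ge0_integral_measure_sum.
Qed.

Lemma data_distribution_setT : (0 < N)%N -> data_distribution x N setT = 1.
Proof.
move=> N0; transitivity (\int[data_distribution x N]_p (cst 1 p)).
  by rewrite integral_cst // mul1e.
rewrite integral_data_distribution //.
rewrite (eq_bigr (fun=> 1)); last first.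
  move=> k _; rewrite integral_cst // mul1e.
  exact: (@probability_setT _ _ _ (distribution P (transition x k.+1))).
by rewrite sumEFin sumr_const card_ord -EFinM mulVf // pnatr_eq0 -lt0n.
Qed.

End data_distribution_theory.

(** * From a vanishing integral to equality of the densities *)

Section maximizer.
Context {R : realType} {d : nat} {dO : measure_display} {Omega : measurableType dO}.
Variable P : probability Omega R.
Variables (w x : nat -> {RV P >-> 'cV[R]_d}) (As Ss : 'M[R]_d).
Hypothesis Hindep : mutually_independent (fun i : nat => if i is k.+1 then w k else x 0%N).
Hypothesis Htraj : forall i o, x i.+1 o = As *m x i o + sqrtmx Ss *m w i o.
Variable phi : 'cV[R]_d -> R.
Hypothesis Hphi : base_density phi.
Hypothesis Hdens : forall i, has_density (w i) phi.
Hypothesis Sspd : posdefmx Ss.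
Local Open Scope ereal_scope.

Let mphi : measurable_fun setT phi := base_density_measurable Hphi.
Let phi_gt0 : forall v, (0 < phi v)%R := base_density_gt0 Hphi.
Let phi_ge0 : forall v, (0 <= phi v)%R := fun v => ltW (phi_gt0 v).

Let step (y z : 'cV[R]_d) := (As *m y + sqrtmx Ss *m z)%R.

(** Continuity in [z] makes [g (y, step y z)] vanish for all [z], for almost every [y] under the law
    of [x n.+1]. For a fixed [z], that law is then resolved into the state and noise at time [n],
    and continuity in [y] removes the exceptional set of states. *)
Lemma transition_integral0_eq0 n (g : 'cV[R]_d * 'cV[R]_d -> R) :
  measurable_fun setT g -> (forall p, 0 <= g p)%R ->
  (forall y, continuous (fun z => g (y, step y z))) ->
  (forall z, continuous (fun y => g (y, step y z))) ->
  \int[distribution P (transition x n.+1)]_p (g p)%:E = 0 -> forall p, g p = 0%R.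
Proof.
move=> mg g0 gcz gcy.
have mge : measurable_fun setT (EFin \o g) by exact/measurable_EFinP.
have mstep := @measurable_step R d As (sqrtmx Ss).
set G := (fun p : 'cV[R]_d * 'cV[R]_d => _) in mstep.
have mgG : measurable_fun setT (g \o G) by exact: measurableT_comp.
have mgz z : measurable_fun setT (fun y => g (y, step y z)).
  exact: (measurable_fun_pair1 z mgG).
have mI : measurable_fun setT (fun y => \int[@lebV R d]_z ((g (y, step y z))%:E * (phi z)%:E)).
  apply: (@measurable_fun_fubini_tonelli_F _ _ _ _ _ (@lebV R d)
    (fun p => (g (G p))%:E * (phi p.2)%:E)) => [|p].
    apply: emeasurable_funM; apply/measurable_EFinP => //.
    by apply: (measurableT_comp mphi); exact: measurable_snd.
  by rewrite mule_ge0 // lee_fin.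
have I0 y : 0 <= \int[@lebV R d]_z ((g (y, step y z))%:E * (phi z)%:E).
  by apply: integral_ge0 => z _; rewrite mule_ge0 // lee_fin.
have ge0 p : 0 <= (EFin \o g) p by rewrite lee_fin.
rewrite (integral_transition Hindep Htraj mphi phi_ge0 Hdens n.+1 mge ge0).
move=> /(integral0_ae_eq mI I0) gae.
have zero_int (f : 'cV[R]_d -> R) : continuous f -> (forall v, 0 <= f v)%R ->
    \int[@lebV R d]_z ((f z)%:E * (phi z)%:E) = 0 -> forall z, f z = 0%R.
  move=> cf f0 fi z; apply/eqP.
  have /eqP : (f z * phi z = 0)%R.
    apply: (@continuous_integral0 R d (fun v => f v * phi v)%R) => //.
    - by move=> v; apply: continuousM; [exact: cf|exact: base_density_continuous].
    - by move=> v; rewrite mulr_ge0.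
  by rewrite mulf_eq0 [phi z == _]gt_eqF // orbF.
have gz z : \int[distribution P (x n.+1)]_y (g (y, step y z))%:E = 0.
  transitivity (\int[distribution P (x n.+1)]_y (cst 0 y)); last by rewrite integral_cst // mul0e.
  apply: ae_eq_integral => //; first exact/measurable_EFinP.
  apply: filterS gae => y h /h {h} /= I0y; congr (_%:E).
  exact: (zero_int (fun z => g (y, step y z))).
have step_unit : sqrtmx Ss \in unitmx by apply: posdefmx_unit; exact: (posdefmx_sqrt Sspd).1.
have gall y z : g (y, step y z) = 0%R.
  have mgze : measurable_fun setT (EFin \o (fun y => g (y, step y z))) by exact/measurable_EFinP.
  have gze0 y1 : 0 <= (EFin \o (fun y => g (y, step y z))) y1 by rewrite lee_fin.
  have := gz z.
  rewrite (integral_state_succ Hindep Htraj mphi phi_ge0 Hdens n mgze gze0).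
  (* One previous state [y0] with zero inner integral suffices: [sqrtmx Ss] is invertible, so
     [step y0] reaches every [y]. *)
  move=> /probability_integral0_ex[||y0].
  - apply: (@measurable_fun_fubini_tonelli_F _ _ _ _ _ (@lebV R d)
      (fun p => (g (step p.1 p.2, step (step p.1 p.2) z))%:E * (phi p.2)%:E)) => [|p].
      apply: emeasurable_funM; apply/measurable_EFinP.
        have mstep2 : measurable_fun setT (fun p : 'cV[R]_d * 'cV[R]_d => step p.1 p.2).
          exact: (measurableT_comp measurable_snd mstep).
        exact: (measurableT_comp (mgz z) mstep2).
      by apply: (measurableT_comp mphi); exact: measurable_snd.
    by rewrite mule_ge0 // lee_fin.
  - by move=> y'; apply: integral_ge0 => z' _; rewrite mule_ge0 // lee_fin.
  move=> h; have := zero_int (fun z' => g (step y0 z', step (step y0 z') z)) _ _ h.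
  have -> : y = step y0 (invmx (sqrtmx Ss) *m (y - As *m y0)).
    by rewrite /step mulKVmx // addrC subrK.
  apply => // v; apply: (@continuous_comp _ _ _ (step y0) (fun y => g (y, step y z))).
    have -> : step y0 = (fun z => sqrtmx Ss *m z + As *m y0)%R.
      by apply/funext => z'; rewrite /step addrC.
    exact: continuous_affine_mx.
  exact: gcy.
move=> [y y']; have := gall y (invmx (sqrtmx Ss) *m (y' - As *m y))%R.
by rewrite /step mulKVmx // addrC subrK.
Qed.

Lemma maximizer_transition_density N A S : (0 < N)%N -> posdefmx S ->
  expected_loglik phi (data_distribution x N) (As, Ss) < +oo ->
  expected_loglik phi (data_distribution x N) (As, Ss) <=
    expected_loglik phi (data_distribution x N) (A, S) ->
  forall y y', transition_density phi A S y y' = transition_density phi As Ss y y'.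
Proof.
move=> N0 Spd Lfin Lle.
pose l := loglik phi A S; pose ls := loglik phi As Ss.
have ml : measurable_fun setT l by exact: measurable_loglik.
have mls : measurable_fun setT ls by exact: measurable_loglik.
pose g p := (expR (l p - ls p) - 1 - (l p - ls p))%R.
have mr : measurable_fun setT (fun p => expR (l p - ls p)).
  by apply: measurableT_comp => //; exact: measurable_funB.
have mg : measurable_fun setT g.
  by apply: measurable_funB; [exact: measurable_funB|exact: measurable_funB].
have g0 p : (0 <= g p)%R by have := expR_ge1Dx (l p - ls p); rewrite /g; lra.
have gint : \int[data_distribution x N]_p (g p)%:E = 0.
  apply: gibbs_equality => //.
  - exact: data_distribution_setT.
  - rewrite integral_data_distribution //; last first.
      by apply: measurable_funeneg; exact/measurable_EFinP.
    apply: lte_mul_pinfty => //; apply: lte_sum_pinfty => k _.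
    rewrite (integral_transition Hindep Htraj mphi phi_ge0 Hdens) //; last first.
      by apply: measurable_funeneg; exact/measurable_EFinP.
    pose a := ln (\det (sqrtmx Ss))^-1.
    have dTs := posdefmx_det_gt0 (posdefmx_sqrt Sspd).1.
    (* In the noise variable the negative part does not involve [y], so its inner integral is the
       constant [K]. *)
    pose K := \int[@lebV R d]_z ((Num.max (- (a + ln (phi z))) 0)%R%:E * (phi z)%:E).
    have K0 : 0 <= K.
      by apply: integral_ge0 => z _; rewrite mule_ge0 // lee_fin // le_max lexx orbT.
    rewrite (eq_integral (cst K)); last first.
      move=> y _; apply: eq_integral => z _; congr (_ * _).
      rewrite funenegE /= EFin_max; congr (maxe (- _)%:E _).
      by rewrite /ls /loglik /= transition_density_noise // lnM ?posrE ?invr_gt0.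
    have KE : K = (fine K)%:E by rewrite fineK // ge0_fin_numE // integral_neg_log_density.
    rewrite KE integral_cst //.
    by rewrite [X in _ * X](@probability_setT _ _ _ (distribution P (x k.+1))) mule1 ltry.
  - rewrite integral_data_distribution //; last exact/measurable_EFinP.
    rewrite (eq_bigr (fun=> 1)); last first.
      move=> k _; rewrite (integral_transition Hindep Htraj mphi phi_ge0 Hdens) //; last first.
        exact/measurable_EFinP.
      rewrite (eq_integral (cst 1)); last by move=> y _; exact: integral_transition_density.
      by rewrite integral_cst // mul1e; exact: (@probability_setT _ _ _ (distribution P (x k.+1))).
    by rewrite sumEFin sumr_const card_ord -EFinM mulVf // pnatr_eq0 -lt0n.
(* A vanishing sum of nonnegative terms with positive weight; its term [k = 0] is the transition
   from [x 1] to [x 2]. *)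
have g1 : \int[distribution P (transition x 1)]_p (g p)%:E = 0.
  move: gint; rewrite integral_data_distribution //; last exact/measurable_EFinP.
  move=> /eqP; rewrite mule_eq0 eqe invr_eq0 pnatr_eq0 -leqn0 leqNgt N0 /=.
  rewrite seq_psume_eq0 => [/allP/(_ (Ordinal N0) (mem_index_enum _))/eqP //|k _].
  by apply: integral_ge0 => p _; rewrite lee_fin.
have cont M1 M2 b1 b2 :
    continuous (fun v : 'cV[R]_d => g (M1 *m v + b1, M2 *m v + b2)%R).
  have cl : continuous (fun v : 'cV[R]_d => l (M1 *m v + b1, M2 *m v + b2)%R).
    exact: continuous_loglik_affine.
  have cls : continuous (fun v : 'cV[R]_d => ls (M1 *m v + b1, M2 *m v + b2)%R).
    exact: continuous_loglik_affine.
  pose u (v : 'cV[R]_d) : R :=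
    (l (M1 *m v + b1, M2 *m v + b2) - ls (M1 *m v + b1, M2 *m v + b2))%R.
  have cu : continuous u by move=> v; exact: (continuousB (cl v) (cls v)).
  have ce : continuous (fun v => expR (u v)).
    move=> v; apply: (@continuous_comp _ _ _ u (@expR R)); first exact: cu.
    exact: continuous_expR.
  move=> v; apply: (@continuousB _ _ _ (fun v => expR (u v) - 1)%R u); last exact: cu.
  by apply: continuousB; [exact: ce|exact: cst_continuous].
have gE : forall p, g p = 0%R.
  apply: (transition_integral0_eq0 mg g0 _ _ g1) => [y|z].
    have := cont 0%R (sqrtmx Ss) y (As *m y)%R.
    by under eq_fun do rewrite mul0mx add0r addrC.
  have := cont 1%:M As 0%R (sqrtmx Ss *m z)%R.
  by under eq_fun do rewrite mul1mx addr0.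
move=> y y'; apply: ln_inj; rewrite ?posrE ?transition_density_gt0 //.
apply/eqP; rewrite -subr_eq0 -[X in X == _]/(l (y, y') - ls (y, y'))%R.
(* The inequality [1 + t < expR t] is strict for [t != 0], so [g = 0] forces equal log-densities. *)
apply: contraT => /expR_gt1Dx; have := gE (y, y'); rewrite /g; lra.
Qed.

End maximizer.

(** [Hfin] excludes the value [+oo], and [HN] the case [N = 0], where [data_distribution] is the
    zero measure and every parameter is a maximizer. *)
Theorem lemma2 (R : realType) (d : nat)
    (phi : 'cV[R]_d -> R) (Hphi : base_density phi)
    (ThetaA ThetaS : set 'M[R]_d)
    (HThetaS : forall S, ThetaS S -> posdefmx S)
    (As Ss : 'M[R]_d)
    (Hint : parameter_interior (ThetaA `*` ThetaS) (As, Ss))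
    (Hident : forall A1 S1 A2 S2,
        (ThetaA `*` ThetaS) (A1, S1) -> (ThetaA `*` ThetaS) (A2, S2) ->
        ((forall x x' : 'cV[R]_d,
            transition_density phi A1 S1 x x' = transition_density phi A2 S2 x x')
         <-> (A1, S1) = (A2, S2)))
    (dO : measure_display) (Omega : measurableType dO) (P : probability Omega R)
    (w : nat -> {RV P >-> 'cV[R]_d})
    (Hdens : forall i, has_density (w i) phi)
    (Hmean : forall i, zero_mean (w i))
    (Hcov : forall i, identity_covariance (w i))
    (x : nat -> {RV P >-> 'cV[R]_d})
    (Hindep : mutually_independent (fun i : nat => if i is k.+1 then w k else x 0%N))
    (Htraj : forall i o, x i.+1 o = As *m x i o + sqrtmx Ss *m w i o)
    (N : nat) (HN : (0 < N)%N)
    (Hfin : (expected_loglik phi (data_distribution x N) (As, Ss) < +oo)%E) :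
  argmax (ThetaA `*` ThetaS) (expected_loglik phi (data_distribution x N)) =
    [set (As, Ss)].
Proof.
have [ThA ThS] : (ThetaA `*` ThetaS) (As, Ss) by exact: (interior_subset Hint).
have unique A S : ThetaA A -> ThetaS S ->
    (expected_loglik phi (data_distribution x N) (As, Ss) <=
     expected_loglik phi (data_distribution x N) (A, S))%E -> (A, S) = (As, Ss).
  move=> TA TS Lle; apply/Hident => // y y'.
  exact: (maximizer_transition_density Hindep Htraj Hphi Hdens (HThetaS _ ThS)
    HN (HThetaS _ TS) Hfin Lle).
apply/seteqP; split => [[A S] /= [[TA TS] Lmax]|_ ->].
  exact: unique (Lmax (As, Ss) (conj ThA ThS)).
(* Maximality follows from [unique]: a parameter with a strictly larger value would equal
   [(As, Ss)]. *)
split; [exact: conj ThA ThS|move=> [A S] /= [TA TS]; rewrite leNgt].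
apply/negP => Llt.
have [EA ES] := unique A S TA TS (ltW Llt).
by move: Llt; rewrite EA ES ltxx.
Qed.
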